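(* Let $G=(V,D,B)$ be a mixed graph, and let $G_A$ be the subgraph induced by an ancestral set $A\subset V$. Then for all $\Lambda\in\mathbb{R}^D_{\mathrm{reg}}$ and $\Omega\in\mathit{PD}(B)$, we have $$\phi_{G_A}(\Lambda_{A,A},\Omega_{A,A}) \;=\; \left[\phi_G(\Lambda,\Omega)\right]_{A,A}.$$
   Context: A mixed graph $G=(V,D,B)$ has a finite vertex set $V$, a set $D\subseteq V\times V$ of directed edges $i\to j$, and a set $B$ of bidirected edges, which are unordered pairs $i\leftrightarrow j$; there are no loops. Directed cycles are allowed. The parents of $i$ are $\mathrm{pa}(i)=\{j\in V: j\to i\in D\}$. A set $A\subseteq V$ is ancestral if $i\in A$ implies $\mathrm{pa}(i)\subseteq A$. The subgraph induced by $A$ is $G_A=(A,D_A,B_A)$, where $D_A=D\cap(A\times A)$ and $B_A$ is the set of edges in $B$ with both endpoints in $A$. $\mathbb{R}^D$ is the set of real $V\times V$ matrices $\Lambda=(\lambda_{ij})$ with $\lambda_{ij}=0$ if $i\to j\notin D$, and $\mathbb{R}^D_{\mathrm{reg}}$ is the subset of those $\Lambda$ with $I-\Lambda$ invertible. $\mathit{PD}_V$ is the cone of positive definite symmetric $V\times V$ matrices, and $\mathit{PD}(B)=\{\Omega\in\mathit{PD}_V:\omega_{ij}=0 \text{ if } i\ne j \text{ and } i\leftrightarrow j\notin B\}$. The map $\phi_G:\mathbb{R}^D_{\mathrm{reg}}\times\mathit{PD}(B)\to\mathit{PD}_V$ is $\phi_G(\Lambda,\Omega)=(I-\Lambda)^{-T}\Omega(I-\Lambda)^{-1}$;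 $\phi_{G_A}$ is the same map for the mixed graph $G_A$. For a $V\times V$ matrix $M$, $M_{A,A}$ denotes the $A\times A$ principal submatrix. *)

(* Defs.v *)
From mathcomp Require Import all_boot all_order all_algebra.
From mathcomp Require Import reals.

Set Implicit Arguments.
Unset Strict Implicit.
Unset Printing Implicit Defensive.

Import Order.TTheory GRing.Theory Num.Theory.
Local Open Scope ring_scope.

(* (i, j) \in dir G encodes i -> j, and [set i; j] \in bidir G encodes
   i <-> j; a bidirected loop would be the one-element set [set i]. *)
Record mixed_graph (V : finType) := MixedGraph {
  dir : {set V * V};
  bidir : {set {set V}};
  dir_noloop : forall i : V, (i, i) \notin dir;
  bidir_pair : forall e : {set V}, e \in bidir -> #|e| = 2%N
}.

Definition pa (V : finType) (G : mixed_graph V) (i : V) : {set V} :=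
  [set j | (j, i) \in dir G].

Definition ancestral (V : finType) (G : mixed_graph V) (A : {set V}) : Prop :=
  forall i : V, i \in A -> pa G i \subset A.

Definition induced_dir (V : finType) (G : mixed_graph V) (A : {set V}) :
    {set {i : V | i \in A} * {i : V | i \in A}} :=
  [set p | (val p.1, val p.2) \in dir G].

Definition induced_bidir (V : finType) (G : mixed_graph V) (A : {set V}) :
    {set {set {i : V | i \in A}}} :=
  [set e : {set {i : V | i \in A}} | [set val i | i in e] \in bidir G].

Lemma induced_dir_noloop (V : finType) (G : mixed_graph V) (A : {set V})
    (i : {i : V | i \in A}) : (i, i) \notin induced_dir G A.
Proof. by rewrite inE dir_noloop. Qed.

Lemma induced_bidir_pair (V : finType) (G : mixed_graph V) (A : {set V})
    (e : {set {i : V | i \in A}}) : e \in induced_bidir G A -> #|e| = 2%N.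
Proof.
by rewrite inE => /bidir_pair; rewrite card_imset //; apply: val_inj.
Qed.

Definition induced (V : finType) (G : mixed_graph V) (A : {set V}) :
    mixed_graph {i : V | i \in A} :=
  MixedGraph (@induced_dir_noloop V G A) (@induced_bidir_pair V G A).

(* A V x V matrix is a matrix of order #|V|, the row and the column of i : V
   being those of index enum_rank i. *)
Notation "''VM[' R ]_ V" := 'M[R]_#|{: V}|
  (at level 0, R at level 200, V at level 2, only parsing) : type_scope.

Definition entry (R : Type) (V : finType) (M : 'VM[R]_V) (i j : V) : R :=
  M (enum_rank i) (enum_rank j).

Definition principal (R : Type) (V : finType) (A : {set V}) (M : 'VM[R]_V) :
    'VM[R]_{i : V | i \in A} :=
  \matrix_(k, l) entry M (val (enum_val k)) (val (enum_val l)).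

Definition RD (R : realType) (V : finType) (G : mixed_graph V)
    (L : 'VM[R]_V) : Prop :=
  forall i j : V, (i, j) \notin dir G -> entry L i j = 0.

Definition RDreg (R : realType) (V : finType) (G : mixed_graph V)
    (L : 'VM[R]_V) : Prop :=
  RD G L /\ 1%:M - L \in unitmx.

Definition posdef (R : realType) (n : nat) (M : 'M[R]_n) : Prop :=
  M^T = M /\ forall x : 'cV[R]_n, x != 0 -> 0 < (x^T *m M *m x) 0 0.

Definition PDB (R : realType) (V : finType) (G : mixed_graph V)
    (O : 'VM[R]_V) : Prop :=
  posdef O /\
  forall i j : V, i != j -> [set i; j] \notin bidir G -> entry O i j = 0.

(* phi G is meant on RDreg G x PDB G only: invmx M is the inverse of M when M is
   invertible, and M itself otherwise. *)
Definition phi (R : realType) (V : finType) (G : mixed_graph V)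
    (L O : 'VM[R]_V) : 'VM[R]_V :=
  (invmx (1%:M - L))^T *m O *m invmx (1%:M - L).

(* Main.v *)
Require Import Defs.
From mathcomp Require Import all_boot all_order all_algebra.
From mathcomp Require Import reals.

(** Let [P] be the V x A matrix whose columns are the unit vectors indexed by
    A, so that [P^T P = 1] and [M_{A,A} = P^T M P] for every M.  As A is
    ancestral, no edge enters A from outside, so the span of these unit vectors
    is invariant under [I - Lambda]:  [(I - Lambda) P = P (I - Lambda_{A,A})].
    Hence [(I - Lambda)^-1 P = P (I - Lambda_{A,A})^-1], and multiplying Omega
    by this identity and its transpose gives the claim. *)

Import GRing.Theory Num.Theory.
Local Open Scope ring_scope.

Section Intertwining.
Context {R : comUnitRingType} {n m : nat}.
Context {P : 'M[R]_(n, m)} {M : 'M[R]_n} {N : 'M[R]_m}.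
Hypotheses (MP : M *m P = P *m N) (Munit : M \in unitmx).

(** [P^T M^-1 P] is a left inverse of [N], because [M^-1 P N = M^-1 M P = P]. *)
Lemma unitmx_intertwined : P^T *m P = 1%:M -> N \in unitmx.
Proof.
move=> PtP; apply: (proj2 (@mulmx1_unit _ _ (P^T *m invmx M *m P) N _)).
by rewrite -mulmxA -MP mulmxA mulmxKV.
Qed.

Lemma invmx_intertwined : N \in unitmx -> invmx M *m P = P *m invmx N.
Proof.
move=> Nunit; apply: (can_inj (mulKmx Munit)).
by rewrite mulKVmx // mulmxA MP mulmxK.
Qed.

End Intertwining.

(** [P^T P = 1] makes [P] injective, so the form at a nonzero [x] is that of [M] at the nonzero
    vector [P x]. *)
Lemma posdef_congruence (R : realType) (n m : nat) (P : 'M[R]_(n, m))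
    (M : 'M[R]_n) :
  P^T *m P = 1%:M -> posdef M -> posdef (P^T *m M *m P).
Proof.
move=> PtP [Msym Mpos]; split=> [|x x_neq0].
  by rewrite !trmx_mul trmxK Msym mulmxA.
have Px_neq0 : P *m x != 0.
  apply: contraNneq x_neq0 => Px0.
  by rewrite -[x]mul1mx -PtP -mulmxA Px0 mulmx0.
by have := Mpos _ Px_neq0; rewrite trmx_mul !mulmxA.
Qed.

Section Principal.
Context {R : realType} {V : finType} (A : {set V}).

Definition subset_rank (k : 'I_#|{: {i : V | i \in A}}|) : 'I_#|{: V}| :=
  enum_rank (val (enum_val k)).

Lemma subset_rank_inj : injective subset_rank.
Proof. by move=> k l /enum_rank_inj/val_inj/enum_val_inj. Qed.

(** This is the matrix [P] above, built so that products with it or its transpose become selections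
    of columns or rows. *)
Definition selection : 'M[R]_(#|{: V}|, #|{: {i : V | i \in A}}|) :=
  colsub subset_rank 1%:M.

Lemma mulmx_selection p (M : 'M[R]_(p, #|{: V}|)) :
  M *m selection = colsub subset_rank M.
Proof. by rewrite mulmx_colsub mulmx1. Qed.

Lemma tr_selection_mulmx p (M : 'M[R]_(#|{: V}|, p)) :
  selection^T *m M = rowsub subset_rank M.
Proof. by rewrite trmx_mxsub trmx1 mul_rowsub_mx mul1mx. Qed.

Lemma principalE (M : 'M[R]_#|{: V}|) :
  principal A M = selection^T *m M *m selection.
Proof.
by rewrite tr_selection_mulmx mulmx_selection; apply/matrixP=> k l; rewrite !mxE.
Qed.

Lemma tr_selectionK : selection^T *m selection = 1%:M.
Proof.
rewrite tr_selection_mulmx; apply/matrixP=> k l.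
by rewrite !mxE (inj_eq subset_rank_inj).
Qed.

Lemma entry_principal (M : 'M[R]_#|{: V}|) (i j : {i : V | i \in A}) :
  entry (principal A M) i j = entry M (val i) (val j).
Proof. by rewrite /entry mxE !enum_rankK. Qed.

Lemma mulmx_selection_principal (M : 'M[R]_#|{: V}|) :
    (forall i j : V, i \notin A -> j \in A -> entry M i j = 0) ->
  M *m selection = selection *m principal A M.
Proof.
move=> M0; apply/matrixP=> k l; rewrite mulmx_selection !mxE.
have [kA|kA] := boolP (enum_val k \in A); last first.
  (* Row outside [A]: the left entry is 0 by [M0], and row [k] of [selection] is zero. *)
  rewrite big1 => [|h _].
    by rewrite -(M0 _ (val (enum_val l)) kA (valP _)) /entry enum_valK.
  rewrite !mxE; case: eqP => [def_k|_]; last by rewrite mul0r.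
  by case/negP: kA; rewrite def_k enum_rankK (valP (enum_val h)).
(* Row in [A]: [h] is its index within [A], and only the term at [h] survives in the product. *)
pose h := enum_rank (exist (fun i => i \in A) _ kA).
have rank_h : subset_rank h = k by rewrite /subset_rank enum_rankK enum_valK.
rewrite (bigD1 h) //= big1 => [|h' h'h].
  by rewrite !mxE rank_h eqxx mul1r addr0 /entry -/(subset_rank h) rank_h.
by rewrite !mxE -rank_h (inj_eq subset_rank_inj) eq_sym (negPf h'h) mul0r.
Qed.

End Principal.

Theorem theorem5p1 (R : realType) (V : finType) (G : mixed_graph V)
    (A : {set V}) (hA : ancestral G A) (L O : 'VM[R]_V)
    (hL : RDreg G L) (hO : PDB G O) :
  [/\ RDreg (induced G A) (principal A L),
      PDB (induced G A) (principal A O) &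
      phi (induced G A) (principal A L) (principal A O)
        = principal A (phi G L O)].
Proof.
case: hL hO => [L0 Lunit] [Opos O0].
pose P := selection (R := R) A.
have PtP : P^T *m P = 1%:M := tr_selectionK A.
have LP : (1%:M - L) *m P = P *m (1%:M - principal A L).
  rewrite mulmxBl mulmxBr mul1mx mulmx1 mulmx_selection_principal // => i j iA jA.
  apply: L0; apply: contra iA => ij.
  by apply: (subsetP (hA j jA)); rewrite inE.
(* This gives the regularity of the induced parameters, and makes [invmx] a genuine inverse in the
   last goal. *)
have LAunit := unitmx_intertwined LP Lunit PtP.
split.
- split=> // i j ij; rewrite entry_principal L0 //.
  by rewrite inE in ij.
- split=> [|i j i_neq_j ij]; first by rewrite principalE; apply: posdef_congruence.
  rewrite entry_principal O0 //.
  by rewrite inE imsetU1 imset_set1 in ij.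
- have invP := invmx_intertwined LP Lunit LAunit.
  rewrite /phi [RHS]principalE (principalE A O) -/P !mulmxA.
  (* Regrouping shows [(I - L)^-1 P] on the right of [O] and its transpose on the left, so [invP]
     applies at both ends. *)
  by rewrite -[in RHS]trmx_mul -[in RHS]mulmxA invP trmx_mul !mulmxA.
Qed.
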